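(* Let $L,n\ge 1$, let $\mu^\bullet=(\mu^0,\mu^1,\ldots,\mu^{L-1})$ be an $L$-multipartition in which every $\mu^k$ is a single column with $|\mu^k|$ boxes, let $\mu=(\mu_1\ge\mu_2\ge\cdots\ge\mu_L)$ be the partition whose parts are the numbers $|\mu^k|$, and let $\lambda=(\lambda_1,\ldots,\lambda_n)$ be a sequence of nonnegative integers with $\lambda_1+\cdots+\lambda_n=|\mu|$. Then the map $$\Psi':\mathrm{Tab}^L(\mu^\bullet,\lambda)\to \mathrm{RC}'(\lambda,\mu)$$ defined by the algorithm given in the context is a statistic preserving bijection; that is, $\Psi'$ is a bijection and $\mathrm{inv}(T)=\tilde c'(\Psi'(T))$ for all $T\in \mathrm{Tab}^L(\mu^\bullet,\lambda)$.
   Context: **Multitableaux.** Partitions are drawn in French convention: row $1$ is the bottom row and is the longest; rows and columns are indexed from $1$; $\nu_i$ denotes the $i$-th part of $\nu$ (zero if $i$ exceeds the number of parts), $\nu\subset\nu'$ denotes containment, $\nu^t$ is the transpose. A Young tableau is a filling by positive integers weakly increasing along rows (left to right) and strictly increasing up columns. An $L$-multitableau of shape $\mu^\bullet$ and weight $\lambda=(\lambda_1,\ldots,\lambda_n)$ is an $L$-tuple $T=(T^0,\ldots,T^{L-1})$ of Young tableaux over $\{1,\ldots,n\}$, $T^k$ of shape $\mu^k$, such that the letter $a$ occurs $\lambda_a$ times in total in $T$, $1\le a\le n$. The set of these is $\mathrm{Tab}^L(\mu^\bullet,\lambda)$. **Inversion statistic.** A cell of $\mu^\bullet$ is a triple $s=(i,j,p)$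 with $0\le p\le L-1$ and $(i,j)$ (row $i$, column $j$) a cell of $\mu^p$. Put $\mathrm{row}(s)=i$, $\mathrm{col}(s)=j$, $\mathrm{diag}(s)=j-i$, $\mathrm{pos}(s)=p$. Write $s\prec s'$ if $\mathrm{diag}(s)<\mathrm{diag}(s')$, or if $\mathrm{diag}(s)=\mathrm{diag}(s')$ and $\mathrm{pos}(s)<\mathrm{pos}(s')$. The standardization of $T$ relabels the $N$ cells of $\mu^\bullet$ by $1,2,\ldots,N$, in order of increasing entry of $T$, cells with equal entries being labeled in $\prec$-increasing order. For a standard multitableau $S$ (entries $1,\ldots,N$ each once), a pair of cells $(s,t)$ is an inversion of $S$ if: (1) $\mathrm{diag}(s)=\mathrm{diag}(t)$ and $\mathrm{pos}(s)<\mathrm{pos}(t)$, or $\mathrm{diag}(s)=\mathrm{diag}(t)-1$ and $\mathrm{pos}(s)>\mathrm{pos}(t)$; (2) $\mathrm{row}(s)\le \mathrm{row}(t)$; (3) $S(t)<S(s)<S(t\!\uparrow)$, where $t\!\uparrow$ is the cell directly above $t$ in the same component and $S(t\!\uparrow)=\infty$ if this cell is not in $\mu^\bullet$. $\mathrm{inv}(S)$ is the number of inversions of $S$, and $\mathrm{inv}(T)$ is defined as $\mathrm{inv}$ of the standardization of $T$. **Rigged configurations (antisymmetric case).** A configuration is a chain of partitions $\emptyset=\nu^{(0)}\subset\nu^{(1)}\subset\cdots\subset\nu^{(n-1)}\subset\nu^{(n)}$ such that each $\nu^{(a)}/\nu^{(a-1)}$, $1\le a\le n$, is a horizontal strip (at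 most one box in each column). Set $m_i^{(a)}=\nu_i^{(a)}-\nu_{i+1}^{(a+1)}$ and $p_i^{(a)}=\nu_i^{(a+1)}-\nu_i^{(a)}$ (vacancy numbers). A rigging $J$ attaches to each of the last $m_i^{(a)}$ boxes of row $i$ of $\nu^{(a)}$, $1\le a\le n-1$, a label (quantum number), an integer $j$ with $0\le j\le p_i^{(a)}$; riggings that differ by reordering labels within the same row of the same $\nu^{(a)}$ are identified. Thus $J$ is a family of multisets $J_i^{(a)}$ of $m_i^{(a)}$ integers in $\{0,\ldots,p_i^{(a)}\}$; $|J_i^{(a)}|$ denotes the sum of the elements of $J_i^{(a)}$. A quantum number in row $i$ of $\nu^{(a)}$ equal to $p_i^{(a)}$ is called singular. $\mathrm{RC}'(\lambda,\mu)$ is the set of all such rigged configurations $(\nu,J)$ with $\nu^{(n)}=\mu^t$ and $\nu^{(a)}/\nu^{(a-1)}$ a horizontal strip with exactly $\lambda_a$ boxes for each $1\le a\le n$. Its statistic is $$\tilde c'(\nu,J)=\sum_{1\le a\le n-1,\;1\le i\le\mu_1}|J_i^{(a)}|.$$ **Algorithm for $\Psi'$.** Let $T\in\mathrm{Tab}^L(\mu^\bullet,\lambda)$ and write the entries of the single column $T^k$, from bottom to top, as $t^k_1<t^k_2<\cdots<t^k_{|\mu^k|}$. 1. Start with the empty rigged configuration (all $\nu^{(a)}=\emptyset$, $0\le a\le n$). 2. Process the letters $t^k_i$ in the order $k=L-1,L-2,\ldots,0$ and, for each $k$, $i=1,2,\ldots,|\mu^k|$. Processing $t=t^k_i$ means: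 for every $a$ with $t\le a<n$, add a box to row $i$ of $\nu^{(a)}$ and give this new box a singular quantum number (equal to $p_i^{(a)}$ after the step, i.e. add this value to $J_i^{(a)}$); moreover, if $i\ge2$, for every $a$ with $t-1\le a<n$ remove one singular quantum number (equal to $p_{i-1}^{(a)}$) from row $i-1$ of $\nu^{(a)}$, i.e. from $J_{i-1}^{(a)}$ (only the label is removed, not a box). The (unrigged) partition $\nu^{(n)}$ also receives a box in row $i$. All other quantum numbers are left unchanged. 3. After all letters have been processed, invert all quantum numbers: each quantum number $j$ in row $i$ of $\nu^{(a)}$ is replaced by $p_i^{(a)}-j$. The result is $\Psi'(T)$. *)

(* Defs.v *)
From HB Require Import structures.
From mathcomp Require Import all_boot all_order all_algebra.
From mathcomp Require Import finmap multiset.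

Set Implicit Arguments.
Unset Strict Implicit.
Unset Printing Implicit Defensive.

Local Open Scope nat_scope.

(* Conventions.  Rows and columns are numbered from 0, row 0 being the bottom
   (longest) one: row i of the mathematics is row i.-1 here, and likewise for
   columns.  Letters are the natural numbers 1, ..., n, and the multiplicity
   of the letter a.+1 is the a-th entry of the weight. *)

(** Partitions *)

Definition is_part (nu : seq nat) : bool := sorted geq nu && (0 \notin nu).

Notation part_nth nu i := (nth 0 nu i).

Definition conj_part (nu : seq nat) : seq nat :=
  [seq count (fun r => j < r) nu | j <- iota 0 (head 0 nu)].

(* The empty partition counts as a column with 0 boxes. *)
Definition is_column (nu : seq nat) : bool := nu == nseq (sumn nu) 1.

Definition horizontal_strip (inner outer : seq nat) : Prop :=
  (forall i, part_nth inner i <= part_nth outer i) /\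
  (forall j, count (fun i => part_nth inner i <= j < part_nth outer i)
                   (iota 0 (size outer)) <= 1).

Definition is_multipart (L : nat) (mu : L.-tuple (seq nat)) : Prop :=
  forall k : 'I_L, is_part (tnth mu k).

(* Null sizes are dropped, so as to obtain a partition in the sense of
   is_part. *)
Definition sizes_part (L : nat) (mu : L.-tuple (seq nat)) : seq nat :=
  [seq h <- sort geq [seq sumn (tnth mu k) | k <- enum 'I_L] | 0 < h].

(** Multitableaux *)

(* A filling is the list of its rows, from bottom to top. *)
Definition filling := seq (seq nat).

Definition entry (t : filling) (i j : nat) : nat := nth 0 (nth [::] t i) j.

Definition is_tableau (n : nat) (nu : seq nat) (t : filling) : Prop :=
  [/\ shape t = nu,
      (forall r, r \in t -> forall x, x \in r -> 0 < x <= n),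
      (forall r, r \in t -> sorted leq r)
    & (forall i j, j < part_nth nu i.+1 -> entry t i j < entry t i.+1 j)].

Definition is_multitableau (L n : nat) (mu : L.-tuple (seq nat))
    (lambda : n.-tuple nat) (T : L.-tuple filling) : Prop :=
  (forall k : 'I_L, is_tableau n (tnth mu k) (tnth T k)) /\
  (forall a : 'I_n,
     \sum_(k < L) count_mem a.+1 (flatten (tnth T k)) = tnth lambda a).

(** The inversion statistic *)

Section Inversions.

Variables (L : nat) (mu : L.-tuple (seq nat)).

Definition cell : Type := (nat * nat * 'I_L)%type.

Definition crow (s : cell) : nat := s.1.1.
Definition ccol (s : cell) : nat := s.1.2.
Definition cpos (s : cell) : 'I_L := s.2.
Definition cdiag (s : cell) : int := ((ccol s)%:Z - (crow s)%:Z)%R.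
Definition cup (s : cell) : cell := ((crow s).+1, ccol s, cpos s).

Definition in_diagram (s : cell) : bool :=
  ccol s < part_nth (tnth mu (cpos s)) (crow s).

Definition cells : seq cell :=
  flatten [seq [seq (i, j, p) | i <- iota 0 (size (tnth mu p)),
                                j <- iota 0 (part_nth (tnth mu p) i)]
          | p <- enum 'I_L].

Definition cprec (s s' : cell) : bool :=
  (cdiag s < cdiag s')%R || ((cdiag s == cdiag s') && (cpos s < cpos s')).

Definition mentry (T : L.-tuple filling) (s : cell) : nat :=
  entry (tnth T (cpos s)) (crow s) (ccol s).

(* The label of s is one plus the number of cells labelled before it.  Cells
   with equal entries in a multitableau are totally ordered by cprec, since
   the entries along a diagonal of a tableau are distinct. *)
Definition standardization (T : L.-tuple filling) (s : cell) : nat :=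
  (count (fun s' => (mentry T s' < mentry T s) ||
                    ((mentry T s' == mentry T s) && cprec s' s)) cells).+1.

Definition is_inversion (S : cell -> nat) (s t : cell) : bool :=
  [&& ((cdiag s == cdiag t) && (cpos s < cpos t)) ||
      ((cdiag s == cdiag t - 1)%R && (cpos t < cpos s)),
      crow s <= crow t,
      S t < S s
    & in_diagram (cup t) ==> (S s < S (cup t))].

Definition inv_standard (S : cell -> nat) : nat :=
  count (fun st => is_inversion S st.1 st.2)
        [seq (s, t) | s <- cells, t <- cells].

Definition inv_stat (T : L.-tuple filling) : nat :=
  inv_standard (standardization T).

End Inversions.

(** Rigged configurations *)

Section RiggedConfigurations.

Variable n : nat.

Definition configuration : Type := {ffun 'I_n.+1 -> seq nat}.

(* For (nu, J) and a < n, the i-th item of J a is the multiset of quantum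
   numbers of row i of nu a.  The list J a has one multiset per row of nu a; it
   is empty for a = 0, as nu 0 is, and nu n carries no rigging. *)
Definition rigged : Type :=
  (configuration * {ffun 'I_n -> seq {mset nat}%mset})%type.

Definition conf_row (nu : configuration) (a i : nat) : nat :=
  part_nth (nu (inord a)) i.

(* Both subtractions are exact when nu is a chain of horizontal strips. *)
Definition num_labels (nu : configuration) (a i : nat) : nat :=
  conf_row nu a i - conf_row nu a.+1 i.+1.

Definition vacancy (nu : configuration) (a i : nat) : nat :=
  conf_row nu a.+1 i - conf_row nu a i.

Definition labels (J : {ffun 'I_n -> seq {mset nat}%mset})
    (a : 'I_n) (i : nat) : {mset nat}%mset := nth mset0 (J a) i.

Definition is_configuration (lambda : n.-tuple nat) (mu : seq nat)
    (nu : configuration) : Prop :=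
  [/\ (forall a, is_part (nu a)),
      nu ord0 = [::],
      nu ord_max = conj_part mu
    & (forall a : 'I_n,
        horizontal_strip (nu (inord a)) (nu (inord a.+1)) /\
        sumn (nu (inord a.+1)) = sumn (nu (inord a)) + tnth lambda a)].

Definition is_rigging (nu : configuration)
    (J : {ffun 'I_n -> seq {mset nat}%mset}) : Prop :=
  forall a : 'I_n,
    size (J a) = size (nu (inord a)) /\
    (forall i, i < size (J a) ->
       size (labels J a i) = num_labels nu a i /\
       (forall q, q \in labels J a i -> q <= vacancy nu a i)).

Definition is_rigged_conf (lambda : n.-tuple nat) (mu : seq nat)
    (X : rigged) : Prop :=
  is_configuration lambda mu X.1 /\ is_rigging X.1 X.2.

Definition rc_stat (mu : seq nat) (X : rigged) : nat :=
  \sum_(a < n | 0 < a) \sum_(i < head 0 mu) \sum_(q <- labels X.2 a i) q.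

(** The algorithm *)

Definition rc_empty : rigged := ([ffun _ => [::]], [ffun _ => [::]]).

Definition add_label (Ja : seq {mset nat}%mset) (i q : nat) :=
  set_nth mset0 Ja i (q +` nth mset0 Ja i)%mset.

Definition remove_label (Ja : seq {mset nat}%mset) (i q : nat) :=
  set_nth mset0 Ja i (nth mset0 Ja i `\ q)%mset.

(* Processing the letter t of row i of a column.  The vacancy numbers of the
   rows i and i.-1 are taken after the boxes have been added; those of row
   i.-1 are not affected by the step. *)
Definition process (X : rigged) (ti : nat * nat) : rigged :=
  let: (t, i) := ti in
  let nu : configuration :=
    [ffun a : 'I_n.+1 => if t <= a then incr_nth (X.1 a) i else X.1 a] in
  (nu,
   [ffun a : 'I_n =>
     let Ja := if t <= a then add_label (X.2 a) i (vacancy nu a i)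
               else X.2 a in
     if (0 < i) && (t.-1 <= a)
     then remove_label Ja i.-1 (vacancy nu a i.-1) else Ja]).

Definition invert (X : rigged) : rigged :=
  (X.1,
   [ffun a : 'I_n =>
     [seq seq_mset [seq vacancy X.1 a i - q | q <- labels X.2 a i]
     | i <- iota 0 (size (X.2 a))]]).

(* The letters of a column (entries of column 0), paired with their rows, from
   bottom to top. *)
Definition column_letters (t : filling) : seq (nat * nat) :=
  [seq (entry t i 0, i) | i <- iota 0 (size t)].

Definition Psi' (L : nat) (T : L.-tuple filling) : rigged :=
  invert (foldl process rc_empty
    (flatten [seq column_letters (tnth T k) | k <- rev (enum 'I_L)])).

End RiggedConfigurations.

Arguments Psi' n {L} T.

(* Main.v *)
Require Import Defs.
From HB Require Import structures.
From mathcomp Require Import all_boot all_order all_algebra.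
From mathcomp Require Import finmap multiset.
From mathcomp Require Import zify.

(** Encode a column of letters by its heights: its height at level a is the
    number of its letters at most a, so a column is a chain of heights that
    starts at 0 and goes up by 0 or 1 at each level.  A multitableau of columns
    is then a family of L such chains, and the partition at level a built by
    the algorithm is the conjugate of the heights at that level.

    Consider the step from level a to level a + 1 and a row i, and list, in the
    order of the components, the columns whose height after the step is i
    (rows and heights counted from 1 here).  Each of them either had this
    height already or has just grown into it: this is a binary word, with
    m_i^(a) letters of the first kind (true) and p_i^(a) of the second (false).
    The columns are processed from the last to the first, a label is created
    with the current vacancy number as its value, and it survives exactly when
    the column stays at height i during the step.  Hence the surviving labels
    are, for each true of the word, the number of falses after it
    ([process_rcons]), and inversion turns them into the numbers of falses
    before it ([invert_rc_of], [Psi'_closed_form]).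

    Words with m trues and p falses correspond to multisets of m integers
    between 0 and p in this way ([falses_before_mset_inj],
    [falses_before_mset_surj]).  As the heights at level n are the given sizes
    of the columns, the words of a step give the heights below from the heights
    above; going down level by level, the partitions and riggings determine the
    columns, and they can be prescribed ([rc_of_inj], [rc_of_surj]).  This
    works for the sizes of the components in any order.

    The statistic of the result is the number of pairs of a false before a
    true, over all words. Such a pair consists of a letter x = a + 1 in row i
    of a component and of a later component whose letter in row i is below x
    while the next one is above x: an inversion between two cells of the same
    diagonal. In columns, the pairs on adjacent diagonals violate the
    condition on the rows, so these are all the inversions ([is_inversionE]). *)

Set Implicit Arguments.
Unset Strict Implicit.
Unset Printing Implicit Defensive.

Local Open Scope nat_scope.

(** * Binary words and multisets *)

(** The offset z counts falses standing before the word. *)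
Fixpoint falses_before (z : nat) (w : seq bool) : seq nat :=
  if w is b :: w' then
    if b then z :: falses_before z w' else falses_before z.+1 w'
  else [::].

Fixpoint falses_after (w : seq bool) : seq nat :=
  if w is b :: w' then
    if b then count negb w' :: falses_after w' else falses_after w'
  else [::].

Lemma size_falses_before z w : size (falses_before z w) = count id w.
Proof. by elim: w z => [|[] w IH] z //=; rewrite IH. Qed.

Lemma size_falses_after w : size (falses_after w) = count id w.
Proof. by elim: w => [|[] w IH] //=; rewrite IH. Qed.

Lemma falses_before_bounds z w q :
  q \in falses_before z w -> z <= q <= z + count negb w.
Proof.
elim: w z => [|[] w IH] z //=; last by move/IH; lia.
by rewrite inE => /orP[/eqP->|/IH]; lia.
Qed.

Lemma sorted_falses_before z w : sorted leq (falses_before z w).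
Proof.
elim: w z => [|[] w IH] z //=; rewrite path_sortedE; last exact: leq_trans.
rewrite IH andbT; apply/allP => q /falses_before_bounds; lia.
Qed.

Lemma falses_after_before z w :
  [seq z + count negb w - q | q <- falses_after w] = falses_before z w.
Proof.
elim: w z => [|[] w IH] z //=; last first.
  by rewrite -IH; apply: eq_map => q; lia.
by rewrite add0n IH addnK.
Qed.

(** A true in front contributes z, and a false in front pushes all values
    above z, so the first letters agree. *)
Lemma falses_before_inj z w1 w2 :
  count negb w1 = count negb w2 ->
  falses_before z w1 = falses_before z w2 -> w1 = w2.
Proof.
have not_both z' x y : falses_before z'.+1 x <> z' :: y.
  move=> e; have := @falses_before_bounds z'.+1 x z'.
  by rewrite e mem_head => /(_ isT); lia.
elim: w1 z w2 => [|b1 w1 IH] z [|b2 w2] //=.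
- by case: b2 => //= [] [].
- by case: b1 => //= [] [].
- case: b1; case: b2 => /= c e.
  + by case: e => /IH-> //; move: c; lia.
  + by case: (@not_both z w2 (falses_before z w1)).
  + by case: (@not_both z w1 (falses_before z w2)).
  + by rewrite (IH _ _ _ e) //; move: c; lia.
Qed.

Lemma falses_before_shift k z w :
  falses_before z (nseq k false ++ w) = falses_before (z + k) w.
Proof.
by elim: k z => [|k IH] z /=; rewrite ?addn0 // IH addSnnS.
Qed.

(** A word is a lattice path in a box whose sides count its two letters, and
    the numbers of falses before its trues are the parts of the partition that
    it cuts off; every partition in the box is cut off by a path. *)
Lemma falses_before_surj z p s :
  sorted leq s -> all (fun q => z <= q <= z + p) s ->
  exists2 w, falses_before z w = s & count negb w = p.
Proof.
elim: s z p => [|x s IH] z p /=.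
  move=> _ _; exists (nseq p false); last by rewrite count_nseq /= mul1n.
  by elim: p z => //= p IH z; rewrite IH.
rewrite path_sortedE; last exact: leq_trans.
case/andP=> /allP xs s_sorted /andP[x_bd /allP s_bd].
have [|w <- cw] := IH x (p - (x - z)) s_sorted.
  by apply/allP => q qs; have := xs q qs; have := s_bd q qs; lia.
exists (nseq (x - z) false ++ true :: w).
  rewrite falses_before_shift subnKC //=; lia.
by rewrite count_cat count_nseq /= mul1n cw; lia.
Qed.

(** The values come in increasing order, so no information is lost in passing
    to multisets. *)
Lemma falses_before_mset_inj w1 w2 :
  count negb w1 = count negb w2 ->
  seq_mset (falses_before 0 w1) = seq_mset (falses_before 0 w2) -> w1 = w2.
Proof.
move=> c /eq_seq_msetP e; apply: (@falses_before_inj 0) c _.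
by apply: (sorted_eq leq_trans anti_leq) e; exact: sorted_falses_before.
Qed.

Lemma falses_before_mset_surj p (A : {mset nat}%mset) :
  (forall q, q \in A -> q <= p) ->
  exists2 w, seq_mset (falses_before 0 w) = A & count negb w = p.
Proof.
move=> bd; have [||w e cw] := @falses_before_surj 0 p (sort leq A).
- exact: sort_sorted leq_total _.
- by apply/allP => q; rewrite mem_sort => /bd; lia.
exists w => //; rewrite e -[RHS]seq_mset_id; apply/eq_seq_msetP.
by rewrite perm_sort.
Qed.

Lemma seq_mset_cons (q : nat) s : seq_mset (q :: s) = (q +` seq_mset s)%mset.
Proof. by apply/msetP => x; rewrite mset1DE !mset_seqE /= eq_sym. Qed.

Lemma sum_falses_beforeS z w :
  \sum_(x <- falses_before z.+1 w) x = \sum_(x <- falses_before z w) x + count id w.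
Proof.
elim: w z => [|[] w IH] z /=; first by rewrite !big_nil.
  by rewrite !big_cons IH; lia.
by rewrite IH.
Qed.

(** * Partitions dual to a family of heights *)

Section Dual.

Variables (K : Type) (ks : seq K).

(** The conjugate of a family of heights has rows [above f i]; it is defined on
    the family itself, since the words below depend on its order. *)
Definition above (f : K -> nat) (i : nat) : nat := count (fun k => i < f k) ks.

Definition dual (f : K -> nat) : seq nat :=
  mkseq (above f) (\max_(k <- ks) f k).

Lemma above_max f i : \max_(k <- ks) f k <= i -> above f i = 0.
Proof.
rewrite /above; elim: ks => //= k s IH; rewrite big_cons geq_max.
by case/andP=> ki /IH->; rewrite ltnNge ki.
Qed.

Lemma above_gt0 f i : i < \max_(k <- ks) f k -> 0 < above f i.
Proof.
rewrite /above; elim: ks => [|k s IH]; first by rewrite big_nil.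
by rewrite big_cons leq_max /= => /orP[->|/IH]; lia.
Qed.

Lemma nth_dual f i : nth 0 (dual f) i = above f i.
Proof.
have [lt|ge] := ltnP i (\max_(k <- ks) f k); first by rewrite nth_mkseq.
by rewrite nth_default ?size_mkseq // above_max.
Qed.

Lemma above_le f i j : i <= j -> above f j <= above f i.
Proof. by move=> ij; apply: sub_count => k /=; apply: leq_ltn_trans. Qed.

Lemma dual_is_part f : is_part (dual f).
Proof.
apply/andP; split.
  apply/(sortedP 0) => i _; rewrite !nth_dual; exact: above_le.
by apply/negP => /mapP[i]; rewrite mem_iota /= => /above_gt0; case: (above f i).
Qed.

(** Both sides count the boxes of the diagram. *)
Lemma sumn_dual f : sumn (dual f) = \sum_(k <- ks) f k.
Proof.
have sum_above M : all (fun k => f k <= M) ks ->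
    \sum_(i < M) above f i = \sum_(k <- ks) f k.
  rewrite /above; elim: ks => [|k s IH] /=.
    by move=> _; rewrite big_nil big1.
  case/andP=> kM sM; rewrite big_cons -IH // big_split /=; congr addn.
  rewrite -[RHS](card_ord (f k)) -sum1_card (big_ord_widen M (fun _ => 1)) //.
  by rewrite [RHS]big_mkcond; apply: eq_bigr => i _; case: ltnP.
rewrite sumnE big_map -[X in iota _ X]subn0 -/(index_iota _ _) big_mkord sum_above //.
elim: ks => //= k s IH; rewrite big_cons leq_maxl; apply: sub_all IH => j.
by rewrite leq_max => ->; rewrite orbT.
Qed.

End Dual.

Lemma above_map (K K' : Type) (c : K -> K') ks f i :
  above (map c ks) f i = above ks (f \o c) i.
Proof. exact: count_map. Qed.

Lemma dual_map (K K' : Type) (c : K -> K') ks f :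
  dual (map c ks) f = dual ks (f \o c).
Proof.
by rewrite /dual big_map; apply: eq_mkseq => i; rewrite above_map.
Qed.

Lemma eq_in_above (K : eqType) (ks : seq K) f g :
  {in ks, f =1 g} -> above ks f =1 above ks g.
Proof. by move=> fg i; apply: eq_in_count => k kk; rewrite fg. Qed.

Lemma eq_in_dual (K : eqType) (ks : seq K) f g :
  {in ks, f =1 g} -> dual ks f = dual ks g.
Proof.
move=> fg; rewrite /dual (eq_big_seq g) //.
by apply: eq_mkseq => i; rewrite (eq_in_above fg).
Qed.

Lemma part_nth_gt0 nu i : is_part nu -> (0 < nth 0 nu i) = (i < size nu).
Proof.
case/andP=> _ nu0; have [lt|ge] := ltnP i (size nu); last by rewrite nth_default.
by rewrite lt0n; apply: contraNneq nu0 => <-; rewrite mem_nth.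
Qed.

Lemma part_nth_le nu i : is_part nu -> nth 0 nu i.+1 <= nth 0 nu i.
Proof.
case/andP=> /(sortedP 0) so _; have [lt|ge] := ltnP i.+1 (size nu).
  exact: so.
by rewrite nth_default.
Qed.

(** Null parts are excluded from a partition, so its rows determine its size. *)
Lemma part_ext nu nu' :
  is_part nu -> is_part nu' -> nth 0 nu =1 nth 0 nu' -> nu = nu'.
Proof.
move=> p p' e; have sz : size nu = size nu'.
  apply/eqP; rewrite eqn_leq; apply/andP; split; rewrite leqNgt.
    by rewrite -part_nth_gt0 // e part_nth_gt0 // ltnn.
  by rewrite -part_nth_gt0 // -e part_nth_gt0 // ltnn.
by apply: (eq_from_nth (x0 := 0)) => // i _; exact: e.
Qed.

Lemma conj_part_dual (K : Type) (ks : seq K) (f : K -> nat) :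
  conj_part [seq h <- sort geq [seq f k | k <- ks] | 0 < h] = dual ks f.
Proof.
set s := filter _ _.
have s_sorted : sorted geq s.
  apply: sorted_filter; first by move=> x y z; rewrite /geq /=; lia.
  by apply: sort_sorted => x y; rewrite /geq /=; lia.
have headE : head 0 s = \max_(h <- s) h.
  case: s s_sorted => [_|x s] /=; first by rewrite big_nil.
  rewrite path_sortedE; last by move=> ? ? ?; rewrite /geq /=; lia.
  case/andP=> /allP xs _; rewrite big_cons; apply/esym/maxn_idPl.
  by apply/bigmax_leqP_seq => y /xs.
have aboveE j : count (fun r => j < r) s = above ks f j.
  rewrite count_filter /above -(count_map f (fun h => j < h)).
  have /permP-> : perm_eq (sort geq [seq f k | k <- ks]) [seq f k | k <- ks].
    by rewrite perm_sort.
  by apply: eq_count => h /=; lia.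
rewrite /conj_part headE /dual; suff -> : \max_(h <- s) h = \max_(k <- ks) f k.
  exact: eq_map.
rewrite big_filter (perm_big [seq f k | k <- ks]) ?perm_sort //=.
by rewrite big_map big_mkcond; apply: eq_bigr => k _; case: (f k).
Qed.

(** For partitions, two boxes in one column can be found in adjacent rows, which
    makes a horizontal strip the same as interlacing rows. *)
Lemma horizontal_stripP inner outer :
  is_part inner -> is_part outer ->
  (horizontal_strip inner outer <->
   forall i, nth 0 outer i.+1 <= nth 0 inner i <= nth 0 outer i).
Proof.
move=> pi po; split=> [[sub str] i|int].
  rewrite sub andbT leqNgt; apply/negP => lt.
  have := str (nth 0 inner i); apply/negP; rewrite -ltnNge.
  (* Otherwise the strip has boxes of column [inner_i] in rows i and i.+1. *)
  have io : i.+1 < size outer by rewrite -part_nth_gt0 //; lia.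
  have -> : size outer = i + (1 + (1 + (size outer - i.+2))) by lia.
  have := sub i; have := part_nth_le i pi; have := part_nth_le i po.
  rewrite !iotaD !count_cat /= !add0n !addn0 addn1; lia.
split=> [i|j]; first by case/andP: (int i).
have decr i k : nth 0 outer (i + k.+1) <= nth 0 inner i.
  elim: k => [|k IH]; first by rewrite addn1; case/andP: (int i).
  by apply: leq_trans IH; rewrite addnS part_nth_le.
rewrite -size_filter; set s := filter _ _.
have: uniq s by rewrite filter_uniq ?iota_uniq.
have: {in s &, forall i k, i = k}.
  move=> i k; rewrite !mem_filter => /andP[hi _] /andP[hk _].
  have [lt|lt|//] := ltngtP i k.
    by have := decr i (k - i.+1); rewrite addnS -addSn subnKC //; lia.
  by have := decr k (i - k.+1); rewrite addnS -addSn subnKC //; lia.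
case: s => [|x [|y s]] //= eqs.
by rewrite (eqs x y) ?inE ?eqxx ?orbT.
Qed.

(** * The words of a growth step *)

(** When the heights go from f to g, the members that end at height i.+1 are
    listed with true for those that stay and false for those that grow: the
    height i.+1 means that row i, counted from 0, is the top one. *)
Definition row_word (K : Type) (ks : seq K) (f g : K -> nat) (i : nat) :
  seq bool := [seq f k == i.+1 | k <- ks & g k == i.+1].

Definition grows (K : Type) (f g : K -> nat) (k : K) : bool :=
  f k <= g k <= (f k).+1.

Lemma row_word_cons K ks k f g i : @row_word K (k :: ks) f g i =
  if g k == i.+1 then (f k == i.+1) :: row_word ks f g i
  else row_word ks f g i.
Proof. by rewrite /row_word /=; case: ifP. Qed.

Section Words.

Variable (K : Type).
Implicit Types (ks : seq K) (f g : K -> nat).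

Lemma row_word_map (K' : Type) (c : K' -> K) (ks' : seq K') f g :
  row_word (map c ks') f g =1 row_word ks' (f \o c) (g \o c).
Proof. by move=> i; rewrite /row_word filter_map -map_comp. Qed.

(** The members that grow into height i.+1 account for the new boxes of row i;
    their number is the vacancy number. *)
Lemma above_falses ks f g i : all (grows f g) ks ->
  above ks g i = above ks f i + count negb (row_word ks f g i).
Proof.
rewrite /above /row_word /grows.
elim: ks => //= k s IH /andP[gk /IH->]; case: (g k =P i.+1) => /=; lia.
Qed.

(** A member above i before the step either is above i.+1 after it or stays at
    i.+1; the latter are the members that carry the labels of row i. *)
Lemma above_trues ks f g i : all (grows f g) ks ->
  above ks f i = above ks g i.+1 + count id (row_word ks f g i).
Proof.
rewrite /above /row_word /grows.
elim: ks => //= k s IH /andP[gk /IH->]; case: (g k =P i.+1) => /=; lia.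
Qed.

Lemma row_word_no_trues ks f g i :
  above ks f i = 0 -> count id (row_word ks f g i) = 0.
Proof.
rewrite /above /row_word; elim: ks => //= k s IH.
by case: (g k == i.+1) => /=; case: (f k =P i.+1) => /= [->|_]; lia.
Qed.

End Words.

Section FiniteFamily.

Variable (K : eqType).
Implicit Types (ks : seq K) (f g : K -> nat).

Lemma eq_in_row_word ks f f' g g' :
  {in ks, f =1 f'} -> {in ks, g =1 g'} ->
  row_word ks f g =1 row_word ks f' g'.
Proof.
move=> ff gg i; rewrite /row_word.
rewrite (@eq_in_filter _ _ (fun k => g' k == i.+1)); last by move=> k /gg->.
by apply/eq_in_map => k; rewrite mem_filter => /andP[_ /ff->].
Qed.

(** Each member occurs in the word of its height after the step, so reading all
    the words along the list recovers who has grown. *)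
Lemma row_word_inj ks f f' g :
  all (grows f g) ks -> all (grows f' g) ks ->
  row_word ks f g =1 row_word ks f' g -> {in ks, f =1 f'}.
Proof.
rewrite /row_word; elim: ks => //= k s IH /andP[fk /IH{}IH] /andP[f'k /IH{}IH] e.
have [ek es] : f k = f' k /\ (forall i,
    [seq f j == i.+1 | j <- s & g j == i.+1] =
    [seq f' j == i.+1 | j <- s & g j == i.+1]).
  move: fk f'k; rewrite /grows; case gk : (g k) => [|i0] fk f'k.
    split=> [|i]; first lia.
    by have := e i; rewrite gk.
  have := e i0; rewrite gk eqxx /= => -[e0 es0].
  split=> [|i]; first lia.
  by have := e i; rewrite gk; case: eqP => [[<-]|].
by move=> j; rewrite inE => /orP[/eqP->|/(IH es)].
Qed.

(** Going along the list, each member consumes the next letter of the word of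
    its height, and the sizes ensure that no word runs out. *)
Lemma row_word_surj ks g (w : nat -> seq bool) :
  uniq ks ->
  (forall i, size (w i) = count (fun k => g k == i.+1) ks) ->
  exists2 f, (forall k, grows f g k) & row_word ks f g =1 w.
Proof.
rewrite /row_word.
elim: ks w => [|k s IH] w /=.
  move=> _ sz; exists g => [k|i]; first by rewrite /grows leqnn leqnSn.
  by apply/esym/size0nil; rewrite sz.
case/andP=> ks us sz.
(* If g k = 0, there is no word to consume: g k - ~~ b is 0 for either b. *)
pose b := head true (w (g k).-1).
have [|f fg fw] := IH (fun i => if g k == i.+1 then behead (w i) else w i) us.
  move=> i; have := sz i; case: ifP => _; rewrite ?size_behead; lia.
have fs i : [seq (if j == k then g k - ~~ b else f j) == i.+1
              | j <- s & g j == i.+1] = [seq f j == i.+1 | j <- s & g j == i.+1].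
  apply/eq_in_map => j; rewrite mem_filter => /andP[_ js].
  by case: (j =P k) => // jk; rewrite -jk js in ks.
exists (fun j => if j == k then g k - ~~ b else f j) => [j|i].
  by rewrite /grows; case: (j =P k) => [->|_]; [lia|exact: fg].
have := sz i; have := fw i; rewrite -fs; case: (g k =P i.+1) => [gk|_] //= ->.
rewrite eqxx /b gk /=; case: (w i) => // -[] w' _.
  by rewrite subn0 eqxx.
by rewrite subn1 /= ltn_eqF.
Qed.

(** The sum counts the pairs of a false standing before a true; lt is the
    order of the list, in terms of its members. *)
Lemma sum_falses_before (lt : rel K) ks f g i :
  pairwise lt ks -> (forall x y, lt x y -> ~~ lt y x) ->
  \sum_(x <- falses_before 0 (row_word ks f g i)) x =
  \sum_(p <- ks) \sum_(q <- ks)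
     [&& lt p q, g p == i.+1, f p != i.+1, g q == i.+1 & f q == i.+1].
Proof.
move=> + asym; elim: ks => [|k s IH]; first by rewrite !big_nil.
have irr : lt k k = false by apply/negP => kk; have := asym _ _ kk; rewrite kk.
case/andP=> /allP k_s /IH{}IH; rewrite row_word_cons.
have trues : count id (row_word s f g i) =
    \sum_(q <- s) (g q == i.+1) && (f q == i.+1).
  rewrite /row_word count_map count_filter -sum1_count big_mkcond.
  by apply: eq_bigr => q _ /=; rewrite andbC; case: (_ && _).
rewrite big_cons big_cons irr /= add0n [in RHS]addnC.
rewrite (eq_big_seq (fun p => \sum_(q <- s)
    [&& lt p q, g p == i.+1, f p != i.+1, g q == i.+1 & f q == i.+1])); last first.
  by move=> p /k_s /asym/negbTE kp; rewrite big_cons kp.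
rewrite -IH (eq_big_seq (fun q =>
    ((g k == i.+1) && (f k != i.+1)) * ((g q == i.+1) && (f q == i.+1)))).
  rewrite -big_distrr -trues /=; case: (g k == i.+1); case: (f k == i.+1) => /=;
    by rewrite ?big_cons ?sum_falses_beforeS; lia.
by move=> q /k_s ->; case: (g k == _); case: (f k == _); rewrite /= ?mul1n.
Qed.

End FiniteFamily.

(** * Rigged configurations read off from growing heights *)

Section RiggedConfigurationOfHeights.

Variables (K : Type) (n : nat).
Implicit Types (ks : seq K) (h : nat -> K -> nat) (lab : seq bool -> seq nat).

Definition rigging_rows lab ks (f g : K -> nat) : seq {mset nat}%mset :=
  mkseq (fun i => seq_mset (lab (row_word ks f g i))) (\max_(k <- ks) f k).

(** The function lab reads the labels off the words: it is [falses_after] before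
    the quantum numbers are inverted, and [falses_before 0] afterwards. *)
Definition rc_of lab ks h : rigged n :=
  ([ffun a : 'I_n.+1 => dual ks (h a)],
   [ffun a : 'I_n => rigging_rows lab ks (h a) (h a.+1)]).

(** Rows above the tallest member have a word without trues, in agreement with
    the default value of nth. *)
Lemma nth_rigging_rows lab ks f g i :
  (forall w, size (lab w) = count id w) ->
  nth mset0 (rigging_rows lab ks f g) i = seq_mset (lab (row_word ks f g i)).
Proof.
move=> szlab; have [lt|ge] := ltnP i (\max_(k <- ks) f k).
  by rewrite nth_mkseq.
rewrite nth_default ?size_mkseq //.
have /size0nil -> // : size (lab (row_word ks f g i)) = 0.
  by rewrite szlab row_word_no_trues // above_max.
by apply/msetP => q; rewrite mset0E mset_seqE.
Qed.

Lemma conf_row_rc_of lab ks h a i :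
  a <= n -> conf_row (rc_of lab ks h).1 a i = above ks (h a) i.
Proof. by move=> an; rewrite /conf_row ffunE nth_dual inordK. Qed.

Lemma vacancy_rc_of lab ks h (a : 'I_n) i :
  all (grows (h a) (h a.+1)) ks ->
  vacancy (rc_of lab ks h).1 a i = count negb (row_word ks (h a) (h a.+1) i).
Proof.
move=> gr; rewrite /vacancy !conf_row_rc_of // ?(ltnW (ltn_ord a)) //.
by rewrite (above_falses _ gr) addKn.
Qed.

Lemma num_labels_rc_of lab ks h (a : 'I_n) i :
  all (grows (h a) (h a.+1)) ks ->
  num_labels (rc_of lab ks h).1 a i = count id (row_word ks (h a) (h a.+1) i).
Proof.
move=> gr; rewrite /num_labels !conf_row_rc_of // ?(ltnW (ltn_ord a)) //.
by rewrite (above_trues _ gr) addKn.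
Qed.

(** Inverting a quantum number complements it in the number of falses of the
    whole word, which turns the falses after a true into those before it. *)
Lemma invert_rc_of ks h :
  (forall a, all (grows (h a) (h a.+1)) ks) ->
  invert (rc_of falses_after ks h) = rc_of (falses_before 0) ks h.
Proof.
move=> gr; congr pair; apply/ffunP => a; rewrite !ffunE size_mkseq.
apply: eq_map => i; rewrite vacancy_rc_of //.
rewrite /labels ffunE nth_rigging_rows; last exact: size_falses_after.
apply/eq_seq_msetP; rewrite -falses_after_before add0n.
exact/perm_map/perm_eq_seq_mset.
Qed.

End RiggedConfigurationOfHeights.

Lemma rc_of_map (K K' : Type) n lab (c : K -> K') ks h :
  rc_of n lab (map c ks) h = rc_of n lab ks (fun a => h a \o c).
Proof.
congr pair; apply/ffunP => a; rewrite !ffunE; first exact: dual_map.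
rewrite /rigging_rows big_map; apply: eq_map => i.
by rewrite row_word_map.
Qed.

Lemma eq_in_rc_of (K : eqType) n lab (ks : seq K) h h' :
  (forall a, a <= n -> {in ks, h a =1 h' a}) ->
  rc_of n lab ks h = rc_of n lab ks h'.
Proof.
move=> hh; congr pair; apply/ffunP => a; rewrite !ffunE.
  by apply: eq_in_dual; apply: hh; rewrite -ltnS.
have ha := hh _ (ltnW (ltn_ord a)); have haS := hh _ (ltn_ord a).
rewrite /rigging_rows (eq_big_seq _ ha); apply: eq_map => i.
by rewrite (eq_in_row_word ha haS).
Qed.

(** * Recovering the heights from a rigged configuration *)

Section Correspondence.

Variables (K : eqType) (n : nat).
Implicit Types (ks : seq K) (f g : K -> nat) (h : nat -> K -> nat).

Notation rc ks h := (@rc_of _ n (falses_before 0) ks h).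

Lemma rc_of_is_rigged_conf ks h (lambda : n.-tuple nat) (mu : seq nat) :
  (forall a, all (grows (h a) (h a.+1)) ks) ->
  {in ks, forall k, h 0 k = 0} ->
  dual ks (h n) = conj_part mu ->
  (forall a : 'I_n,
     \sum_(k <- ks) h a.+1 k = \sum_(k <- ks) h a k + tnth lambda a) ->
  is_rigged_conf lambda mu (rc ks h).
Proof.
move=> gr h0 hn hw; split; first split=> /=.
- by move=> a; rewrite ffunE dual_is_part.
- by rewrite ffunE (eq_in_dual h0) /dual big1_seq.
- by rewrite ffunE.
- move=> a; rewrite !ffunE !inordK ?ltnS // ?(ltnW (ltn_ord a)) //.
  rewrite !sumn_dual hw; split=> //.
  apply/horizontal_stripP; try exact: dual_is_part.
  move=> i; rewrite !nth_dual; apply/andP; split.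
    by rewrite (above_trues _ (gr a)) leq_addr.
  by rewrite (above_falses _ (gr a)) leq_addr.
move=> a /=; rewrite !ffunE inordK ?ltnS ?(ltnW (ltn_ord a)) //.
rewrite !size_mkseq; split=> // i _.
rewrite /labels ffunE (nth_rigging_rows _ _ _ _ (size_falses_before 0)).
rewrite (perm_size (perm_eq_seq_mset _)) size_falses_before.
rewrite -(num_labels_rc_of (falses_before 0)) //; split=> // q.
rewrite (perm_mem (perm_eq_seq_mset _)) => /falses_before_bounds.
by rewrite vacancy_rc_of //; lia.
Qed.

(** Going down from level n, each pair of successive partitions and the
    multisets between them give back the words of one step. *)
Lemma rc_of_inj ks h h' :
  (forall a, all (grows (h a) (h a.+1)) ks) ->
  (forall a, all (grows (h' a) (h' a.+1)) ks) ->
  {in ks, h n =1 h' n} ->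
  rc ks h = rc ks h' -> forall a, a <= n -> {in ks, h a =1 h' a}.
Proof.
move=> gr gr' hn e a an; rewrite -(subKn an).
elim: (n - a) (leq_subr a n) => [|d IH] dn; first by rewrite subn0.
set b := n - d.+1; have bn : b < n by rewrite /b; lia.
have {IH} IH : {in ks, h b.+1 =1 h' b.+1}.
  by rewrite /b -subSn //; apply: IH; lia.
have wE := eq_in_row_word (fun k _ => erefl (h' b k)) IH.
apply: (@row_word_inj _ ks _ _ (h b.+1)) => //.
  rewrite (@eq_in_all _ _ (grows (h' b) (h' b.+1))) // => k kks.
  by rewrite /grows IH.
move=> i; rewrite wE.
apply: falses_before_mset_inj.
  rewrite -!(vacancy_rc_of (n := n) (falses_before 0) (a := Ordinal bn)) //.
  by rewrite e.
move/(congr1 (fun X : rigged n => nth mset0 (X.2 (Ordinal bn)) i)): e.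
by rewrite !ffunE !nth_rigging_rows //; exact: size_falses_before.
Qed.

Lemma above_succ ks g i :
  above ks g i = above ks g i.+1 + count (fun k => g k == i.+1) ks.
Proof. by rewrite /above; elim: ks => //= k s ->; lia. Qed.

(** The multisets and the vacancy numbers prescribe the words of the step, and
    the words give the heights f before the step from the heights g after it;
    the interlacing inequalities make the lengths of the words agree with g. *)
Lemma growth_step_surj ks g inner outer (A : nat -> {mset nat}%mset) :
  uniq ks -> above ks g =1 outer ->
  (forall i, outer i.+1 <= inner i <= outer i) ->
  (forall i, size (A i) = inner i - outer i.+1) ->
  (forall i q, q \in A i -> q <= outer i - inner i) ->
  exists f, [/\ forall k, grows f g k, above ks f =1 inner
    & forall i, seq_mset (falses_before 0 (row_word ks f g i)) = A i].
Proof.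
move=> uks gE strip szA bdA.
have ex i : exists w, (seq_mset (falses_before 0 w) == A i)
                      && (count negb w == outer i - inner i).
  have [w e c] := falses_before_mset_surj (bdA i).
  by exists w; rewrite e c !eqxx.
pose w i := xchoose (ex i).
have wA i : seq_mset (falses_before 0 (w i)) = A i.
  by have /andP[/eqP] := xchooseP (ex i).
have wf i : count negb (w i) = outer i - inner i.
  by have /andP[_ /eqP] := xchooseP (ex i).
have wt i : count id (w i) = inner i - outer i.+1.
  by rewrite -szA -wA (perm_size (perm_eq_seq_mset _)) size_falses_before.
have [|f fg fw] := @row_word_surj _ ks g w uks.
  move=> i; rewrite -(count_predC id) wt (@eq_count _ _ negb) // wf.
  by have := above_succ ks g i; rewrite !gE; have := strip i; lia.
exists f; split=> // [i|i]; last by rewrite fw.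
rewrite (@above_trues _ _ _ g) ?fw ?wt ?gE; last by apply/allP => k _.
by have := strip i; lia.
Qed.

(** Downward induction on the level, starting from the given heights g at
    level n. *)
Lemma rc_of_surj ks g lambda mu (X : rigged n) :
  uniq ks -> dual ks g = conj_part mu -> is_rigged_conf lambda mu X ->
  exists h, [/\ forall a k, grows (h a) (h a.+1) k, h n = g & rc ks h = X].
Proof.
move=> uks gmu [[parts nu0 nun steps] rig].
have down d : d <= n -> exists h, [/\ forall a k, n - d <= a -> grows (h a) (h a.+1) k,
    h n = g,
    forall a, n - d <= a <= n -> above ks (h a) =1 conf_row X.1 a
  & forall a : 'I_n, n - d <= a -> forall i,
    seq_mset (falses_before 0 (row_word ks (h a) (h a.+1) i)) = labels X.2 a i].
  elim: d => [|d IH] dn.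
    (* Constant heights grow at every level, including those beyond n. *)
    exists (fun _ => g); split=> // [a k _|a|a].
    - by rewrite /grows leqnn leqnSn.
    - rewrite subn0 -eqn_leq => /eqP<- i; rewrite -nth_dual gmu -nun.
      by rewrite /conf_row; congr (nth 0 (X.1 _) i); apply/val_inj; rewrite /= inordK.
    - by rewrite subn0 leqNgt ltn_ord.
  have [|h [gr hn habove hrig]] := IH; first lia.
  set b := n - d.+1; have bn : b < n by rewrite /b; lia.
  have [hstrip _] := steps (Ordinal bn).
  have [szJ Jrow] := rig (Ordinal bn).
  have strip := (horizontal_stripP (parts _) (parts _)).1 hstrip.
  have aboveE : above ks (h b.+1) =1 conf_row X.1 b.+1.
    by apply: habove; rewrite /b; lia.
  have szA i : size (labels X.2 (Ordinal bn) i) =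
      conf_row X.1 b i - conf_row X.1 b.+1 i.+1.
    have [lt|ge] := ltnP i (size (X.2 (Ordinal bn))).
      by have [] := Jrow i lt.
    rewrite /labels nth_default // enum_mset0 /=.
    suff -> : conf_row X.1 b i = 0 by [].
    by rewrite /conf_row nth_default // -szJ.
  have bdA i q : q \in labels X.2 (Ordinal bn) i ->
      q <= conf_row X.1 b.+1 i - conf_row X.1 b i.
    have [lt|ge] := ltnP i (size (X.2 (Ordinal bn))).
      by have [_ bd] := Jrow i lt; exact: bd.
    by rewrite /labels nth_default // in_mset0.
  have [f [fg fin frig]] := growth_step_surj uks aboveE strip szA bdA.
  exists (fun a => if a == b then f else h a); split.
  - move=> a k ba; case: (a =P b) => [->|ab]; first by rewrite gtn_eqF.
    by rewrite ifF; [apply: gr|]; move: ba ab; rewrite /b; lia.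
  - by rewrite gtn_eqF.
  - move=> a an; case: (a =P b) => [->//|ab]; apply: habove.
    by move: an ab; rewrite /b; lia.
  move=> a an; case: ((a : nat) =P b) => [ab|ab].
    rewrite ab gtn_eqF // => i; rewrite frig; congr (labels _ _ _).
    exact/val_inj.
  by rewrite ifF; [apply: hrig|]; move: an ab; rewrite /b; lia.
have [h [gr hn habove hrig]] := down n (leqnn n).
rewrite subnn in gr habove hrig.
have dualE (a : 'I_n.+1) : dual ks (h a) = X.1 a.
  apply: part_ext => //; first exact: dual_is_part.
  by move=> i; rewrite nth_dual habove ?leq_ord // /conf_row inord_val.
exists h; split=> // [a k|]; first exact: gr.
rewrite [RHS]surjective_pairing; congr pair.
  by apply/ffunP => a; rewrite ffunE.
apply/ffunP => a; rewrite ffunE; have [szJ _] := rig a.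
apply: (@eq_from_nth _ mset0) => [|i _].
  rewrite szJ -dualE !size_mkseq inordK //.
  by rewrite ltnS ltnW.
by rewrite nth_rigging_rows ?hrig //; exact: size_falses_before.
Qed.

End Correspondence.

(** * The heights of a column of letters *)

Definition height (a : nat) (c : seq nat) : nat := count (fun x => x <= a) c.

Lemma height_rcons a c t : height a (rcons c t) = height a c + (t <= a).
Proof. by rewrite /height -cats1 count_cat /= addn0. Qed.

Lemma height_succ a c : sorted ltn c -> height a.+1 c = height a c + (a.+1 \in c).
Proof.
move=> c_sorted; rewrite -(count_uniq_mem a.+1); last first.
  exact: (sorted_uniq ltn_trans ltnn).
by rewrite /height; elim: (c) => //= x s ->; lia.
Qed.

Lemma grows_height a c : sorted ltn c -> grows (height a) (height a.+1) c.
Proof. by move=> /(height_succ a) e; rewrite /grows e; case: (_ \in _); lia. Qed.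

Lemma height_full a c t :
  sorted ltn (rcons c t) -> t <= a.+1 -> height a c = size c.
Proof.
rewrite sorted_pairwise; last exact: ltn_trans.
rewrite pairwise_rcons => /andP[ct _] ta; apply/eqP; rewrite -all_count.
by apply: sub_all ct => x; rewrite /=; lia.
Qed.

Definition is_letter (n x : nat) : bool := 0 < x <= n.

Lemma height0 n c : all (is_letter n) c -> height 0 c = 0.
Proof.
move/allP=> letters; apply: etrans (count_pred0 c).
by apply: eq_in_count => x /letters /andP[]; case: x.
Qed.

Lemma height_all n c : all (is_letter n) c -> height n c = size c.
Proof.
move=> letters; apply/eqP; rewrite -all_count; apply: sub_all letters.
by move=> x /andP[].
Qed.

(** The letters are the levels at which the height goes up. *)
Lemma column_ext n c c' :
  sorted ltn c -> sorted ltn c' -> all (is_letter n) c -> all (is_letter n) c' ->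
  (forall a, a <= n -> height a c = height a c') -> c = c'.
Proof.
move=> sc sc' /allP lc /allP lc' hh.
apply: (irr_sorted_eq ltn_trans ltnn) => // x.
have [/andP[x0 xn]|nx] := boolP (is_letter n x); last first.
  by rewrite (negbTE (contra (@lc x) nx)) (negbTE (contra (@lc' x) nx)).
have := height_succ x.-1 sc; have := height_succ x.-1 sc'.
rewrite prednK // !hh //; last exact: leq_trans (leq_pred x) xn.
by move=> -> /addnI; case: (x \in c); case: (x \in c').
Qed.

Definition letters_of (n : nat) (h : nat -> nat) : seq nat :=
  [seq a.+1 | a <- iota 0 n & h a < h a.+1].

Lemma letters_of_sorted n h : sorted ltn (letters_of n h).
Proof.
rewrite sorted_map; apply: sorted_filter; first by move=> x y z /=; lia.
exact: iota_ltn_sorted.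
Qed.

Lemma all_letters_of n h : all (is_letter n) (letters_of n h).
Proof.
apply/allP => x /mapP[a]; rewrite mem_filter mem_iota => /andP[_ /andP[_ an]] ->.
by rewrite /is_letter /=; lia.
Qed.

Lemma height_letters_of n h a :
  h 0 = 0 -> (forall b, h b <= h b.+1 <= (h b).+1) -> a <= n ->
  height a (letters_of n h) = h a.
Proof.
move=> h0 gr; elim: a => [|a IH] an; first by rewrite (height0 (all_letters_of n h)).
rewrite height_succ ?letters_of_sorted // IH; last exact: ltnW.
rewrite mem_map; last exact: succn_inj.
by rewrite mem_filter mem_iota /= add0n an andbT; have := gr a; lia.
Qed.

(** As letters increase up the column, those at most a fill exactly its lowest
    rows. *)
Lemma lt_height i a c : sorted ltn c ->
  (i < height a c) = (i < size c) && (nth 0 c i <= a).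
Proof.
rewrite sorted_pairwise; last exact: ltn_trans.
rewrite /height; elim: c i => [|x c IH] i //= /andP[/allP xc c_sorted].
have [xa|ax] := leqP x a.
  by case: i => [|i]; rewrite //= add1n ltnS IH.
rewrite add0n (_ : count _ c = 0).
  apply/esym; case: i => [|i] /=; first by rewrite leqNgt ax.
  apply/negP => /andP[ic]; have := xc _ (mem_nth 0 ic); rewrite /=; lia.
apply: etrans (count_pred0 c); apply: eq_in_count => y /xc; rewrite /=; lia.
Qed.

Lemma grow_letterE i a c : sorted ltn c ->
  (height a.+1 c == i.+1) && (height a c != i.+1) =
  (i < size c) && (nth 0 c i == a.+1).
Proof.
move=> c_sorted; have := grows_height a c_sorted; rewrite /grows.
have := lt_height i a c_sorted; have := lt_height i a.+1 c_sorted.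
have := lt_height i.+1 a.+1 c_sorted.
have [ic|] := ltnP i.+1 (size c); last by lia.
by have /(sortedP 0)/(_ i ic) := c_sorted; rewrite /=; lia.
Qed.

Lemma stay_lettersE i a c : sorted ltn c ->
  (height a.+1 c == i.+1) && (height a c == i.+1) =
  [&& i < size c, nth 0 c i <= a & (i.+1 < size c) ==> (a.+1 < nth 0 c i.+1)].
Proof.
move=> c_sorted; have := grows_height a c_sorted; rewrite /grows.
have := lt_height i a c_sorted; have := lt_height i.+1 a.+1 c_sorted.
lia.
Qed.

(** The inversions between row i of c and row i of d, for c in an earlier
    component, in terms of letters rather than standardized labels. *)
Definition column_inversion (c d : seq nat) (i : nat) : bool :=
  [&& i < size c, i < size d, nth 0 d i < nth 0 c i
    & (i.+1 < size d) ==> (nth 0 c i < nth 0 d i.+1)].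

(** Only the step at which c receives its letter of row i contributes. *)
Lemma sum_column_inversion n c d i :
  sorted ltn c -> sorted ltn d -> all (is_letter n) c ->
  \sum_(a < n) [&& height a.+1 c == i.+1, height a c != i.+1,
                   height a.+1 d == i.+1 & height a d == i.+1] =
  column_inversion c d i.
Proof.
move=> c_sorted d_sorted /allP letters.
rewrite (eq_bigr (fun a : 'I_n => (((i < size c) && (nth 0 c i == a.+1)) &&
    [&& i < size d, nth 0 d i <= a & (i.+1 < size d) ==> (a.+1 < nth 0 d i.+1)]
    : nat))); last first.
  by move=> a _; rewrite andbA grow_letterE // stay_lettersE.
rewrite /column_inversion; have [ic|_] /= := ltnP i (size c); last by rewrite big1.
have /andP[c0 cn] := letters _ (mem_nth 0 ic).
have an : (nth 0 c i).-1 < n by rewrite prednK.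
rewrite (bigD1 (Ordinal an)) //= prednK // eqxx big1 ?addn0.
  by congr nat_of_bool; congr (_ && (_ && _)); rewrite -ltnS prednK.
move=> a; rewrite -val_eqE /= => ne; case: eqP => // e.
by rewrite e /= eqxx in ne.
Qed.

(** * The algorithm in closed form *)

Section Algorithm.

Variable n : nat.

Notation state := (@rc_of _ n falses_after^~ height).

(** The closed form of the state holds in the middle of a column as well, the
    letters processed so far being taken as the whole column; the latest column
    is the head of the list.  Its new letter t affects three ranges of levels.
    For a with a.+1 < t nothing changes.  For t <= a the column stays one row
    higher during the step, which moves its label up by one row.  For t = a.+1
    it grows during the step instead of staying, which deletes its label if it
    has one.  The value of its label is always the number of falses of the tail
    of the word, because it is the first letter of the word. *)
Lemma process_rcons cs c t :
  all (sorted ltn) cs -> sorted ltn (rcons c t) ->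
  process (state (c :: cs)) (t, size c) = state (rcons c t :: cs).
Proof.
move=> cs_sorted c_sorted.
have gr a : all (grows (height a) (height a.+1)) (rcons c t :: cs).
  rewrite /= grows_height //=; apply: sub_all cs_sorted => c'; exact: grows_height.
rewrite /process; set nu := [ffun a => _].
have nuE : nu = (state (rcons c t :: cs)).1.
  apply/ffunP => a; rewrite !ffunE; case: ifP => ta; last first.
    rewrite /dual !big_cons height_rcons ta addn0; apply: eq_map => i.
    by rewrite /above /= height_rcons ta addn0.
  have hc : height a c = size c by apply: (height_full c_sorted); lia.
  apply: (@eq_from_nth _ 0) => [|i _].
    rewrite size_incr_nth !size_mkseq !big_cons height_rcons ta hc addn1.
    by case: ltnP; lia.
  by rewrite nth_incr_nth !nth_dual /above /= height_rcons ta hc; lia.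
congr pair; first exact: nuE.
apply/ffunP => a; rewrite !ffunE nuE !(vacancy_rc_of _ _ (gr a)).
have [a_small|t_le] := ltnP a.+1 t.
  have -> : (t <= a) = false by lia.
  have -> /= : (t.-1 <= a) = false by lia.
  rewrite andbF /rigging_rows !big_cons height_rcons.
  have -> : (t <= a) = false by lia.
  rewrite addn0; apply: eq_map => i.
  rewrite !row_word_cons !height_rcons.
  have [-> ->] : (t <= a) = false /\ (t <= a.+1) = false by lia.
  by rewrite !addn0.
have hc := height_full c_sorted t_le.
have hc' : height a.+1 c = size c by apply: (height_full c_sorted); lia.
have -> : t.-1 <= a by lia.
rewrite andbT; apply: (@eq_from_nth _ mset0) => [|j _].
  rewrite [RHS]size_mkseq big_cons height_rcons.
  case: (t <= a); case: (posnP (size c)) => [c0|c0];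
    rewrite /= ?size_set_nth ?size_mkseq ?big_cons hc; lia.
have wE i : row_word (c :: cs) (height a) (height a.+1) i =
    nseq (size c == i.+1) true ++ row_word cs (height a) (height a.+1) i.
  by rewrite row_word_cons hc hc'; case: (_ == _).
have w'E i : row_word (rcons c t :: cs) (height a) (height a.+1) i =
    nseq (size c == i) (t <= a) ++ row_word cs (height a) (height a.+1) i.
  rewrite row_word_cons !height_rcons hc hc' t_le addn1 eqSS.
  by case: eqP => //= ->; case: (t <= a); rewrite ?addn1 ?addn0 /= ?eqxx ?ltn_eqF.
rewrite [RHS]nth_rigging_rows; last exact: size_falses_after.
have nthE i := nth_rigging_rows (c :: cs) (height a) (height a.+1) i
                 size_falses_after.
rewrite /add_label /remove_label.
(* In row 0 there is no label below to remove; in each of the two cases for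
   the row, t <= a comes before t = a.+1. *)
case: (size c) wE w'E => [|i] wE w'E; case: (t <= a) w'E => /= w'E.
- rewrite nth_set_nth /= !nthE !wE !w'E; case: j => [|j] //=.
  by rewrite seq_mset_cons add0n.
- by rewrite nthE wE w'E; case: (_ == j).
- have [i1 [i2 i3]] : (i == i.+1) = false /\ (i.+1 == i) = false /\
    (i.+1 == i.+2) = false by lia.
  rewrite nth_set_nth /= nth_set_nth /= i1 nth_set_nth /= !nthE !wE !w'E.
  rewrite i2 i3 !eqxx /=; case: (j =P i) => [->|ji].
    by rewrite i2 /= seq_mset_cons msetD1K.
  case: (j =P i.+1) => [->|/eqP ji1].
    by rewrite eqxx /= seq_mset_cons add0n.
  rewrite eqSS (eq_sym i) (eq_sym i.+1) (negPf ji1).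
  by case: (j =P i) ji.
- have i2 : (i.+1 == i) = false by lia.
  rewrite nth_set_nth /= !nthE !wE !w'E i2 !eqxx /=.
  case: (j =P i) => [->|/eqP ji].
    by rewrite i2 /= seq_mset_cons msetD1K.
  by rewrite eqSS eq_sym (negPf ji) /=; case: (_ == j).
Qed.

Lemma process_column cs c :
  all (sorted ltn) cs -> sorted ltn c ->
  foldl (@process n) (state cs) (zip c (iota 0 (size c))) = state (c :: cs).
Proof.
move=> cs_sorted; elim/last_ind: c => [_|c t IH c_sorted].
  congr pair; apply/ffunP => a; rewrite !ffunE.
    by rewrite /dual big_cons max0n; apply: eq_map => i.
  by rewrite /rigging_rows big_cons max0n; apply: eq_map => i.
have c_sorted' : sorted ltn c.
  by move: c_sorted; rewrite -cats1 => /cat_sorted2[].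
rewrite size_rcons -addn1 iotaD cats1 zip_rcons ?size_iota // foldl_rcons IH //.
exact: process_rcons.
Qed.

Lemma process_columns cs :
  all (sorted ltn) cs ->
  foldl (@process n) (rc_empty n)
    (flatten [seq zip c (iota 0 (size c)) | c <- rev cs]) = state cs.
Proof.
elim: cs => [_|c cs IH /= /andP[c_sorted cs_sorted]].
  congr pair; apply/ffunP => a; rewrite !ffunE.
    by rewrite /dual big_nil.
  by rewrite /rigging_rows big_nil.
rewrite rev_cons map_rcons flatten_rcons foldl_cat IH //.
exact: process_column.
Qed.

End Algorithm.

(** * Multitableaux with a single column in each component *)

Definition column (t : filling) : seq nat := mkseq (fun i => entry t i 0) (size t).

Definition of_column (c : seq nat) : filling := [seq [:: x] | x <- c].

Lemma column_of_column c : column (of_column c) = c.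
Proof.
apply: (@eq_from_nth _ 0) => [|i]; rewrite size_mkseq size_map // => ic.
by rewrite nth_mkseq ?size_map // /entry (nth_map 0).
Qed.

Lemma flatten_of_column c : flatten (of_column c) = c.
Proof. by elim: c => //= x c ->. Qed.

(** Rows of size 1 are always weakly increasing, so a tableau on a column is the same as an
    increasing list of letters. *)
Lemma column_tableauP n m t :
  is_tableau n (nseq m 1) t <->
  [/\ t = of_column (column t), size (column t) = m, sorted ltn (column t)
    & all (is_letter n) (column t)].
Proof.
split.
  case=> sh letters _ cols.
  have sz : size t = m by rewrite -(size_map size) -/(shape t) sh size_nseq.
  have rows i : i < m -> nth [::] t i = [:: entry t i 0].
    move=> im; have : size (nth [::] t i) = 1.
      by rewrite -nth_shape sh nth_nseq im.
    by rewrite /entry; case: (nth _ _ _) => [|x []].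
  split.
  - apply: (@eq_from_nth _ [::]) => [|i]; rewrite ?size_map ?size_iota // sz.
    move=> im; rewrite (nth_map 0) ?size_mkseq ?sz // nth_mkseq ?sz //.
    exact: rows.
  - by rewrite size_mkseq.
  - apply/(sortedP 0) => i; rewrite size_mkseq sz => im.
    rewrite !nth_mkseq ?sz //; last exact: ltnW.
    by apply: cols; rewrite nth_nseq im.
  - apply/allP => x /mapP[i]; rewrite mem_iota sz => /= im ->.
    apply: (letters (nth [::] t i)); first by rewrite mem_nth ?sz.
    by rewrite rows // mem_head.
case=> te sz c_sorted /allP letters.
have rows r : r \in t -> exists2 x, x \in column t & r = [:: x].
  by rewrite {1}te => /mapP.
split.
- rewrite te -sz /shape -map_comp; elim: (column t) => //= x c ->.
  by [].
- by move=> r /rows[x xc ->] y; rewrite inE => /eqP->; exact: letters.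
- by move=> r /rows[x xc ->].
- move=> i j; rewrite nth_nseq; case: ifP => // im; case: j => // _.
  move/(sortedP 0)/(_ i): c_sorted; rewrite size_mkseq; rewrite size_mkseq in sz.
  by rewrite sz => /(_ im); rewrite !nth_mkseq ?sz //; exact: ltnW.
Qed.

Section Multitableaux.

Variables (L n : nat) (mu : L.-tuple (seq nat)).
Hypothesis mu_columns : forall k : 'I_L, is_column (tnth mu k).

Implicit Types T : L.-tuple filling.

Definition heights T (a : nat) (k : 'I_L) : nat := height a (column (tnth T k)).

Definition columns_valid T : Prop := forall k : 'I_L,
  [/\ tnth T k = of_column (column (tnth T k)),
      size (column (tnth T k)) = sumn (tnth mu k),
      sorted ltn (column (tnth T k)) & all (is_letter n) (column (tnth T k))].

(** The letters a.+1 are the boxes added between levels a and a.+1, whence the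
    formulation of the weight by sums of heights. *)
Lemma multitableau_columnsP (lambda : n.-tuple nat) T :
  is_multitableau mu lambda T <->
  columns_valid T /\
  (forall a : 'I_n,
     \sum_(k <- enum 'I_L) heights T a.+1 k =
     \sum_(k <- enum 'I_L) heights T a k + tnth lambda a).
Proof.
have tabP k : is_tableau n (tnth mu k) (tnth T k) <->
  [/\ tnth T k = of_column (column (tnth T k)),
      size (column (tnth T k)) = sumn (tnth mu k),
      sorted ltn (column (tnth T k)) & all (is_letter n) (column (tnth T k))].
  by rewrite -column_tableauP -(eqP (mu_columns k)).
have cntE : columns_valid T -> forall a : 'I_n,
    \sum_(k <- enum 'I_L) heights T a.+1 k = \sum_(k <- enum 'I_L) heights T a k
      + \sum_(k < L) count_mem a.+1 (flatten (tnth T k)).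
  move=> val a; rewrite !big_enum /= -big_split /=; apply: eq_bigr => k _.
  have [te _ c_sorted _] := val k.
  rewrite {1}te flatten_of_column /heights height_succ // count_uniq_mem //.
  exact: (sorted_uniq ltn_trans ltnn).
split=> [[tab wt]|[val wt]].
  have val : columns_valid T by move=> k; apply/tabP; exact: tab.
  by split=> // a; rewrite cntE // wt.
split=> [k|a]; first by apply/tabP; exact: val.
by have := wt a; rewrite cntE // => /addnI.
Qed.

Lemma heights_grow T : columns_valid T ->
  forall a, all (grows (heights T a) (heights T a.+1)) (enum 'I_L).
Proof.
by move=> val a; apply/allP => k _; have [_ _ + _] := val k; exact: grows_height.
Qed.

Lemma heights_bottom T : columns_valid T -> forall k, heights T 0 k = 0.
Proof. by move=> val k; have [_ _ _] := val k; exact: height0. Qed.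

Lemma heights_top T : columns_valid T ->
  forall k, heights T n k = sumn (tnth mu k).
Proof. by move=> val k; have [_ <- _] := val k; exact: height_all. Qed.

Lemma Psi'_closed_form T : columns_valid T ->
  Psi' n T = rc_of n (falses_before 0) (enum 'I_L) (heights T).
Proof.
move=> val; rewrite /Psi' -invert_rc_of; last exact: heights_grow.
rewrite -(rc_of_map _ _ (fun k => column (tnth T k))) -process_columns.
  rewrite -map_rev -map_comp; congr (invert (foldl _ _ (flatten _))).
  apply: eq_map => k /=; rewrite size_mkseq /column_letters /column /mkseq.
  by elim: (iota _ _) => //= i s ->.
by apply/allP => _ /mapP[k _ ->]; have [] := val k.
Qed.

Lemma heights_surj (h : nat -> 'I_L -> nat) :
  (forall k, h 0 k = 0) -> (forall a k, grows (h a) (h a.+1) k) ->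
  (forall k, h n k = sumn (tnth mu k)) ->
  exists2 T, columns_valid T & forall a, a <= n -> heights T a =1 h a.
Proof.
move=> h0 gr hn.
exists [tuple of_column (letters_of n (h^~ k)) | k < L].
  move=> k; rewrite tnth_mktuple column_of_column; split=> //.
  - rewrite -(height_all (all_letters_of n _)) height_letters_of //.
    by move=> b; exact: gr.
  - exact: letters_of_sorted.
  - exact: all_letters_of.
move=> a an k; rewrite /heights tnth_mktuple column_of_column.
by rewrite height_letters_of // => b; exact: gr.
Qed.

Lemma heights_inj T1 T2 : columns_valid T1 -> columns_valid T2 ->
  (forall a, a <= n -> heights T1 a =1 heights T2 a) -> T1 = T2.
Proof.
move=> v1 v2 hh; apply: eq_from_tnth => k.
have [e1 _ s1 l1] := v1 k; have [e2 _ s2 l2] := v2 k.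
rewrite e1 e2; congr of_column.
by apply: (column_ext s1 s2 l1 l2) => a an; exact: hh.
Qed.

Lemma dual_column_sizes :
  dual (enum 'I_L) (fun k => sumn (tnth mu k)) = conj_part (sizes_part mu).
Proof. by rewrite /sizes_part conj_part_dual. Qed.

End Multitableaux.

(** * Bijectivity *)

Lemma Psi'_rigged L n (mu : L.-tuple (seq nat)) (lambda : n.-tuple nat) T :
  (forall k : 'I_L, is_column (tnth mu k)) ->
  is_multitableau mu lambda T ->
  is_rigged_conf lambda (sizes_part mu) (Psi' n T).
Proof.
move=> cols /(multitableau_columnsP cols)[val wt].
rewrite (Psi'_closed_form val); apply: rc_of_is_rigged_conf wt.
- exact: heights_grow val.
- by move=> k _; exact: heights_bottom val k.
rewrite -dual_column_sizes; apply: eq_in_dual => k _.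
exact: heights_top val k.
Qed.

Lemma Psi'_inj L n (mu : L.-tuple (seq nat)) (lambda : n.-tuple nat) T1 T2 :
  (forall k : 'I_L, is_column (tnth mu k)) ->
  is_multitableau mu lambda T1 -> is_multitableau mu lambda T2 ->
  Psi' n T1 = Psi' n T2 -> T1 = T2.
Proof.
move=> cols /(multitableau_columnsP cols)[v1 _] /(multitableau_columnsP cols)[v2 _].
rewrite (Psi'_closed_form v1) (Psi'_closed_form v2) => e.
apply: (heights_inj v1 v2) => a an k.
apply: (rc_of_inj (heights_grow v1) (heights_grow v2) _ e an).
  by move=> j _; rewrite (heights_top v1) (heights_top v2).
exact: mem_enum.
Qed.

Lemma Psi'_surj L n (mu : L.-tuple (seq nat)) (lambda : n.-tuple nat) X :
  (forall k : 'I_L, is_column (tnth mu k)) ->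
  is_rigged_conf lambda (sizes_part mu) X ->
  exists2 T, is_multitableau mu lambda T & Psi' n T = X.
Proof.
move=> cols rcX; have [[_ nu0 _ steps] _] := rcX.
have [h [gr hn hX]] :=
  rc_of_surj (enum_uniq 'I_L) (dual_column_sizes mu) rcX.
have h0 k : h 0 k = 0.
  move: nu0; rewrite -hX ffunE /= => /(congr1 size); rewrite size_mkseq.
  move=> /eqP; rewrite -leqn0 => /bigmax_leqP_seq/(_ k).
  by rewrite mem_enum => /(_ isT isT); rewrite leqn0 => /eqP.
have [T val Th] := heights_surj h0 gr (fun k => congr1 (@^~ k) hn).
have inh a : a <= n -> {in enum 'I_L, heights T a =1 h a}.
  by move=> an k _; exact: Th.
exists T; last by rewrite (Psi'_closed_form val) -hX; apply: eq_in_rc_of inh.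
apply/(multitableau_columnsP cols); split=> // a.
have [_] := steps a; rewrite -hX !ffunE !sumn_dual !inordK ?ltnS //; last first.
  exact: ltnW.
by rewrite !(eq_big_seq _ (inh _ _)) //; exact: ltnW.
Qed.

(** * The statistic *)

Lemma count_proper (K : eqType) (a b : pred K) (s : seq K) x :
  subpred a b -> x \in s -> b x -> ~~ a x -> count a s < count b s.
Proof.
move=> ab; elim: s => //= y s IH; rewrite inE => /orP[/eqP<-|xs] bx ax.
  by rewrite bx (negbTE ax) ltnS; exact: sub_count.
by have := IH xs bx ax; have := ab y; case: (a y) => [->//|_]; lia.
Qed.

Section Statistic.

Variables (L n : nat) (mu : L.-tuple (seq nat)).
Hypothesis mu_columns : forall k : 'I_L, is_column (tnth mu k).
Variable T : L.-tuple filling.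
Hypothesis T_valid : columns_valid n mu T.

Notation col k := (column (tnth T k)).
Notation tallest := (head 0 (sizes_part mu)).

Lemma size_col_le k : size (col k) <= tallest.
Proof.
have tallestE : \max_(j <- enum 'I_L) sumn (tnth mu j) = tallest.
  by have /(congr1 size) := dual_column_sizes mu; rewrite !size_mkseq.
rewrite -tallestE; have [_ -> _ _] := T_valid k.
by apply: (leq_bigmax_seq (F := fun k => sumn (tnth mu k))); rewrite ?mem_enum.
Qed.

Lemma part_nth_column k i : part_nth (tnth mu k) i = (i < size (col k)).
Proof.
have [_ -> _ _] := T_valid k; rewrite (eqP (mu_columns k)) nth_nseq sumn_nseq mul1n.
by case: ltnP.
Qed.

Lemma size_component k : size (tnth mu k) = size (col k).
Proof.
by have [_ -> _ _] := T_valid k; rewrite {1}(eqP (mu_columns k)) size_nseq.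
Qed.

Lemma sum_cells (F : cell L -> nat) :
  \sum_(s <- cells mu) F s =
  \sum_(k < L) \sum_(i < tallest) (i < size (col k)) * F (i : nat, 0, k).
Proof.
rewrite /cells big_flatten big_map big_enum /=; apply: eq_bigr => k _.
rewrite big_allpairs_dep size_component -[X in iota _ X]subn0.
rewrite -/(index_iota _ _) big_mkord.
rewrite (big_ord_widen tallest (fun i =>
  \sum_(j <- iota 0 (part_nth (tnth mu k) i)) F (i, j, k))) ?size_col_le //.
rewrite big_mkcond; apply: eq_bigr => i _; rewrite part_nth_column.
by case: ltnP; rewrite ?big_seq1 ?mul1n.
Qed.

Lemma mem_cells k i :
  i < size (col k) -> (i, 0, k) \in (cells mu : seq (nat * nat * 'I_L)).
Proof.
move=> ik; apply/flatten_mapP; exists k; first exact: mem_enum.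
apply/allpairsPdep; exists i, 0; rewrite !mem_iota size_component /= ik.
by rewrite part_nth_column ik.
Qed.

Lemma mentry_column k i :
  i < size (col k) -> mentry T (i, 0, k) = nth 0 (col k) i.
Proof. by rewrite size_mkseq => ik; rewrite nth_mkseq. Qed.

(** Labels are ranks for a strict order, so an earlier cell has a smaller
    label. *)
Lemma standardization_mono (s t : nat * nat * 'I_L) :
  s \in (cells mu : seq (nat * nat * 'I_L)) ->
  (mentry T s < mentry T t) || ((mentry T s == mentry T t) && cprec s t) ->
  standardization mu T s < standardization mu T t.
Proof.
rewrite /standardization ltnS => s_in st.
apply: (@count_proper (nat * nat * 'I_L)%type _ _ _ s) => //.
  rewrite /cprec in st *; move=> u /=; lia.
by rewrite /cprec; lia.
Qed.

(** Cells of columns on adjacent diagonals lie in adjacent rows, in the order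
    forbidden by the condition on rows; only cells of the same row are left.
    Ties in the standardization are harmless: the cell s precedes t when they carry
    the same letter, and the cell above t precedes s as its diagonal is lower,
    so each comparison of labels is the strict comparison of letters. *)
Lemma is_inversionE k l i j : i < size (col k) -> j < size (col l) ->
  is_inversion mu (standardization mu T) (i, 0, k) (j, 0, l) =
  [&& i == j, k < l & column_inversion (col k) (col l) i].
Proof.
move=> ik jl; rewrite /is_inversion /in_diagram /cdiag /cup /crow /ccol /cpos /=.
rewrite part_nth_column; have [ij|ij] := eqVneq i j; last first.
  apply/negbTE/negP => /and4P[Hd Hr _ _]; move: Hd Hr ij; lia.
rewrite -{}ij in jl *; rewrite leqnn eqxx /= lt0b.
have -> : (k < l) || (((0 - i%:Z) == (0 - i%:Z) - 1)%R && (l < k)) = (k < l).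
  by lia.
case kl: (k < l) => //=; rewrite /column_inversion ik jl /=.
congr andb.
  have [lt|le] := ltnP (nth 0 (col l) i) (nth 0 (col k) i).
    by apply: standardization_mono; rewrite ?mem_cells // !mentry_column // lt.
  apply/negbTE; rewrite -leqNgt ltnW //.
  apply: standardization_mono; rewrite ?mem_cells // !mentry_column //.
  by rewrite /cprec /cdiag eqxx kl orbT andbT orbC -leq_eqVlt.
case il: (i.+1 < size (col l)) => //=.
have [lt|le] := ltnP (nth 0 (col k) i) (nth 0 (col l) i.+1).
  by apply: standardization_mono; rewrite ?mem_cells // !mentry_column // lt.
apply/negbTE; rewrite -leqNgt ltnW //.
apply: standardization_mono; rewrite ?mem_cells // !mentry_column //.
have -> : cprec (i.+1, 0, l) (i, 0, k) by rewrite /cprec /cdiag /crow /ccol /=; lia.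
by rewrite andbT orbC -leq_eqVlt.
Qed.

Lemma inv_stat_columns :
  inv_stat mu T =
  \sum_(k < L) \sum_(l < L) \sum_(i < tallest)
     (k < l) && column_inversion (col k) (col l) i.
Proof.
rewrite /inv_stat /inv_standard -sum1_count big_mkcond big_allpairs.
rewrite sum_cells; apply: eq_bigr => k _.
rewrite exchange_big /=; apply: eq_bigr => i _.
have [ik|ki] := ltnP i (size (col k)); last first.
  by rewrite mul0n big1 // => l _; rewrite /column_inversion (ltnNge i) ki andbF.
rewrite mul1n sum_cells; apply: eq_bigr => l _.
rewrite (bigD1 i) //= big1 ?addn0 => [|j ji].
  have [il|li] := ltnP i (size (col l)); last first.
    by rewrite /column_inversion (ltnNge i (size (col l))) li /= !andbF.
  by rewrite mul1n is_inversionE // eqxx /=; case: (_ && _).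
have [jl|//] := ltnP j (size (col l)).
by rewrite is_inversionE // eq_sym (inj_eq val_inj) (negbTE ji).
Qed.

Lemma rc_stat_columns :
  rc_stat (sizes_part mu) (Psi' n T) =
  \sum_(k < L) \sum_(l < L) \sum_(i < tallest)
     (k < l) && column_inversion (col k) (col l) i.
Proof.
rewrite (Psi'_closed_form T_valid) /rc_stat.
have sorted_col k : sorted ltn (col k) by have [] := T_valid k.
have ord_pairwise : pairwise (fun k l : 'I_L => k < l) (enum 'I_L).
  have := iota_ltn_sorted 0 L; rewrite sorted_pairwise; last exact: ltn_trans.
  by rewrite -val_enum_ord pairwise_map.
transitivity (\sum_(a < n) \sum_(i < tallest) \sum_(k < L) \sum_(l < L)
    [&& k < l, height a.+1 (col k) == i.+1, height a (col k) != i.+1,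
        height a.+1 (col l) == i.+1 & height a (col l) == i.+1]).
  rewrite big_mkcond; apply: eq_bigr => a _; case: posnP => [a0|_].
    rewrite a0 big1 // => i _; rewrite big1 // => k _; rewrite big1 // => l _.
    by have := heights_bottom T_valid l; rewrite /heights => ->; rewrite !andbF.
  apply: eq_bigr => i _; rewrite /labels ffunE.
  rewrite nth_rigging_rows; last exact: size_falses_before.
  rewrite (perm_big _ (perm_eq_seq_mset _)) /=.
  rewrite (sum_falses_before _ _ _ ord_pairwise); last by move=> k l; lia.
  by rewrite big_enum; apply: eq_bigr => k _; rewrite big_enum.
rewrite exchange_big /=.
under eq_bigr => i _ do rewrite exchange_big /=.
rewrite exchange_big /=; apply: eq_bigr => k _.
under eq_bigr => i _ do rewrite exchange_big /=.
rewrite exchange_big /=; apply: eq_bigr => l _; apply: eq_bigr => i _.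
have [_ _ _ letters] := T_valid k; case kl: (k < l); last by rewrite big1.
exact: sum_column_inversion.
Qed.

End Statistic.

Theorem theorem4p2 (L n : nat) (mu : L.-tuple (seq nat))
    (lambda : n.-tuple nat) :
  (1 <= L)%N -> (1 <= n)%N ->
  is_multipart mu ->
  (forall k : 'I_L, is_column (tnth mu k)) ->
  sumn lambda = sumn (sizes_part mu) ->
  (* Psi' maps Tab^L(mu, lambda) to RC'(lambda, mu) bijectively *)
  (forall T, is_multitableau mu lambda T ->
     is_rigged_conf lambda (sizes_part mu) (Psi' n T)) /\
  (forall T1 T2, is_multitableau mu lambda T1 -> is_multitableau mu lambda T2 ->
     Psi' n T1 = Psi' n T2 -> T1 = T2) /\
  (forall X, is_rigged_conf lambda (sizes_part mu) X ->
     exists2 T, is_multitableau mu lambda T & Psi' n T = X) /\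
  (* and preserves the statistics *)
  (forall T, is_multitableau mu lambda T ->
     inv_stat mu T = rc_stat (sizes_part mu) (Psi' n T)).
Proof.
move=> _ _ _ cols _; split=> [T|]; first exact: Psi'_rigged.
split=> [T1 T2|]; first exact: Psi'_inj.
split=> [X|T]; first exact: Psi'_surj.
case/(multitableau_columnsP cols)=> val _.
by rewrite (inv_stat_columns cols val) (rc_stat_columns val).
Qed.
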